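(* Let $f\colon\mathbb{R}\times\mathbb{R}^n\to\mathbb{R}^n$ be smooth and let $\chi_{t_0}^{t}(x)$ denote the flow generated by $\dot{x}(t)=f(t,x(t))$. Let $x_0\in\mathbb{R}^n$, let $t_0\in\mathbb{R}$ be the current time, let $h>0$ be a time step, let $M_0\in\mathbb{R}^{n\times n}$ be symmetric positive definite, and let $\delta_0,\Delta_0>0$. If $$\delta_0+\max_{\substack{x\in B_{M_0}(x_0,\Delta_0)\\ s\in[0,h]}}\left\|h\cdot f(t_0+s,x)\right\|_{M_0}\le\Delta_0,$$ then for all $\bar{x}\in B_{M_0}(x_0,\delta_0)$ $$\chi_{t_0}^{[t_0,t_0+h]}(\bar{x})\subset B_{M_0}(x_0,\Delta_0).$$
   Context: For symmetric positive definite $M$, $\|x\|_M=\sqrt{x^TMx}$ and $B_M(x,r)=\{y\in\mathbb{R}^n:\|y-x\|_M\le r\}$ is the closed ball. $\chi_{t_0}^{t}(x)$ denotes the value at time $t$ of the solution of $\dot{x}(t)=f(t,x(t))$ with $x(t_0)=x$. $\chi_{t_0}^{[t_0,t_0+h]}(x)\subset\mathbb{R}^n$ denotes the set of all values $\chi_{t_0}^{t}(x)$ for $t\in[t_0,t_0+h]$; an inclusion for this set is understood to include that the solution exists on $[t_0,t_0+h]$. *)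

(* Defs.v *)
From mathcomp Require Import all_boot all_order all_algebra.
From mathcomp Require Import all_classical all_reals all_analysis.
Set Implicit Arguments.
Unset Strict Implicit.
Unset Printing Implicit Defensive.
Import Order.TTheory GRing.Theory Num.Theory.
Import numFieldNormedType.Exports.
Local Open Scope classical_set_scope.
Local Open Scope ring_scope.

(* C^k for maps out of a finite-dimensional space E: differentiable, with every
   directional derivative of class C^(k-1). In finite dimension this agrees
   with the definition through iterated partial derivatives. *)
Fixpoint Ck (R : realType) (E W : normedModType R) (k : nat) (g : E -> W)
    : Prop :=
  if k is k'.+1 then
    (forall p : E, differentiable g p) /\
    (forall v : E, Ck k' (fun p => 'D_v g p))
  else continuous g.

Definition smooth (R : realType) (E W : normedModType R) (g : E -> W) : Prop :=
  forall k, Ck k g.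

Definition spd (R : realType) (n : nat) (M : 'M[R]_n) : Prop :=
  M^T = M /\ forall x : 'cV[R]_n, x != 0 -> 0 < (x^T *m M *m x) 0 0.

Definition mnorm (R : realType) (n : nat) (M : 'M[R]_n) (x : 'cV[R]_n) : R :=
  Num.sqrt ((x^T *m M *m x) 0 0).

Definition mball (R : realType) (n : nat) (M : 'M[R]_n) (x : 'cV[R]_n) (r : R)
    : set 'cV[R]_n :=
  [set y | mnorm M (y - x) <= r].

Definition is_maximum (R : realType) (A : set R) (m : R) : Prop :=
  A m /\ ubound A m.

(* The default value 0 is returned only when A has no greatest element. *)
Definition maximum (R : realType) (A : set R) : R := xget 0 (is_maximum A).

Definition solves (R : realType) (n : nat) (f : R * 'cV[R]_n -> 'cV[R]_n)
    (J : set R) (u : R -> 'cV[R]_n) : Prop :=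
  forall s, J s -> is_derive s (1 : R) u (f (s, u s)).

(* The flow, as the set of values at time t of solutions through (t0, x) that
   live on an open interval containing both t0 and t: empty when no solution
   reaches t, and the singleton of the value at t of the solution otherwise
   when f is smooth. *)
Definition flow (R : realType) (n : nat) (f : R * 'cV[R]_n -> 'cV[R]_n)
    (t0 t : R) (x : 'cV[R]_n) : set 'cV[R]_n :=
  [set y | exists (a b : R) (u : R -> 'cV[R]_n),
     [/\ t0 \in `]a, b[, t \in `]a, b[, solves f `]a, b[ u,
         u t0 = x & u t = y]].

Definition flow_exists (R : realType) (n : nat) (f : R * 'cV[R]_n -> 'cV[R]_n)
    (t0 t1 : R) (x : 'cV[R]_n) : Prop :=
  exists (a b : R) (u : R -> 'cV[R]_n),
    [/\ `[t0, t1] `<=` `]a, b[, solves f `]a, b[ u & u t0 = x].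

Definition flow_tube (R : realType) (n : nat) (f : R * 'cV[R]_n -> 'cV[R]_n)
    (t0 t1 : R) (x : 'cV[R]_n) : set 'cV[R]_n :=
  \bigcup_(t in `[t0, t1]) flow f t0 t x.

(* Main.v *)
(** Compose f with the clamping of the time to [t0, t0 + h] and a radial
    retraction of the state onto B_M(x0, Delta0): the truncated field is bounded
    and Lipschitz, so Picard iteration gives a global solution v through xbar.
    Its speed in the M-norm is everywhere at most m / h, with m the maximum in
    the hypothesis, so |v(t) - xbar|_M <= m and v(t) stays in B_M(x0, Delta0) on
    [t0, t0 + h]; there the truncation is inactive and v solves the original
    equation.  By Gronwall every solution through xbar agrees with v on
    [t0, t0 + h].  (Uniqueness is really needed when m = 0, as v may then sit on
    the boundary of the ball.)  To reach an open time interval, the construction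
    is repeated with the times clamped to [t0 - 1, t0 + h + 1] and the radius
    Delta0 + 1: the new solution agrees with v on [t0, t0 + h], so it stays in
    the larger ball slightly beyond. *)
Require Import Defs.
From mathcomp Require Import all_boot all_order all_algebra.
From mathcomp Require Import all_classical all_reals all_analysis.
From mathcomp Require Import ring lra.
Import Order.TTheory GRing.Theory Num.Theory.
Import numFieldNormedType.Exports.
Local Open Scope classical_set_scope.
Local Open Scope ring_scope.

Set Implicit Arguments.
Unset Strict Implicit.

(** * Derivatives and antiderivatives *)

Lemma entry_le_norm (R : realType) (m n : nat) (A : 'M[R]_(m, n)) i j :
  `|A i j| <= `|A|.
Proof.
rewrite [leRHS]/Num.Def.normr/= mx_normrE.
exact: (le_bigmax _ (fun ij : 'I_m * 'I_n => `|A ij.1 ij.2|) (i, j)).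
Qed.

Lemma mx_norm_le (R : realType) (m n : nat) (A : 'M[R]_(m, n)) (c : R) :
  0 <= c -> (forall i j, `|A i j| <= c) -> `|A| <= c.
Proof.
move=> c0 Ac; rewrite /Num.Def.normr/= mx_normrE.
by apply: bigmax_le => // -[i j] _; exact: Ac.
Qed.

Lemma is_derive_mxP (R : realType) (m n : nat) (u : R -> 'M[R]_(m, n)) (t : R)
    (du : 'M[R]_(m, n)) :
  is_derive t (1 : R) u du <->
  forall i j, is_derive t (1 : R) (fun s => u s i j) (du i j).
Proof.
split => [[ut <-] i j|ut].
  apply: DeriveDef; first exact: ((derivable_mxP _ _ _).1 ut).
  by rewrite derive_mx// mxE.
have dut : derivable u t 1.
  by apply/derivable_mxP => i j; have [] := ut i j.
apply: DeriveDef => //; rewrite derive_mx//; apply/matrixP => i j.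
by rewrite mxE; have [] := ut i j.
Qed.

Lemma is_derive_continuous {R : realType} {W : normedModType R} (u : R -> W)
    (t : R) (du : W) :
  is_derive t (1 : R) u du -> {for t, continuous u}.
Proof.
by move=> [ut _]; exact/differentiable_continuous/derivable1_diffP.
Qed.

Lemma MVT_closed (R : realType) (F dF : R -> R) (a b : R) : a <= b ->
  (forall s, a <= s <= b -> is_derive s (1 : R) F (dF s)) ->
  exists2 c, a <= c <= b & F b - F a = dF c * (b - a).
Proof.
move=> ab HF.
have cF : {within `[a, b], continuous F}.
  apply: continuous_in_subspaceT => s; rewrite inE/= in_itv/= => sab.
  exact: is_derive_continuous (HF _ sab).
have dFoo s : s \in `]a, b[%R -> is_derive s (1 : R) F (dF s).
  by rewrite in_itv/= => /andP[/ltW as_ /ltW sb]; apply: HF; rewrite as_.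
have [c cab E] := MVT_segment ab dFoo cF.
by exists c => //; move: cab; rewrite in_itv.
Qed.

Lemma derive_le0_le (R : realType) (F dF : R -> R) (a b : R) : a <= b ->
  (forall s, a <= s <= b -> is_derive s (1 : R) F (dF s)) ->
  (forall s, a <= s <= b -> dF s <= 0) -> F b <= F a.
Proof.
move=> ab HF dF0; have [c cab E] := MVT_closed ab HF.
by rewrite -subr_le0 E mulr_le0_ge0 ?dF0 ?subr_ge0.
Qed.

(** First fundamental theorem of calculus for the integral over [[a, x]], applied on [[a, t + 1]] so
    that [t] is interior; this confines the claim to times after [a]. *)
Lemma antiderivative_gt (R : realType) (f : R -> R) (a : R) : continuous f ->
  exists F : R -> R, forall t, a < t -> is_derive t (1 : R) F (f t).
Proof.
move=> cf; exists (fun x => \int[lebesgue_measure]_(t in `[a, x]) f t)%R => t at_.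
have tt1 : t < t + 1 by rewrite ltrDl.
have fi : lebesgue_measure.-integrable `[a, t + 1] (EFin \o f).
  apply: continuous_compact_integrable; first exact: segment_compact.
  exact: continuous_subspaceT.
have [dF F'] := continuous_FTC1_closed tt1 fi at_ (cf t).
by apply: (DeriveDef dF); rewrite -F' derive1E.
Qed.

Lemma is_derive_reflect (R : realType) (F : R -> R) (t d : R) :
  is_derive (- t) (1 : R) F d -> is_derive t (1 : R) (fun s => - F (- s)) d.
Proof.
move=> Fd; have H := @is_derive1_comp R F (-%R) t d (-1) Fd _.
have -> : d = - (d * -1) by ring.
by apply: is_deriveN; apply: H; exact: is_deriveNid.
Qed.

(** An antiderivative [F] to the right of -1 and a reflected one [H] to the left of 1 differ by a
    constant on the overlap; shifted to vanish at 0, they are glued there. *)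
Lemma antiderivative (R : realType) (f : R -> R) (t0 : R) : continuous f ->
  exists2 F : R -> R, F t0 = 0 & forall t, is_derive t (1 : R) F (f t).
Proof.
move=> cf.
have [F HF] := @antiderivative_gt R f (-1) cf.
have [|G HG] := @antiderivative_gt R (fun x => f (- x)) (-1).
  by move=> x; apply: continuous_comp; [exact: opp_continuous|exact: cf].
pose H s := - G (- s).
have dH (t : R) : t < 1 -> is_derive t (1 : R) H (f t).
  move=> t1; rewrite -[t in f t]opprK; apply: is_derive_reflect.
  by apply: HG; rewrite ltrN2.
have FH (t : R) : -1 < t -> t < 1 -> F t - F 0 = H t - H 0.
  move=> t1 t2.
  have D (s : R) : -1 < s -> s < 1 -> is_derive s (1 : R) (fun r => F r - H r) 0.
    move=> s1 s2; rewrite -(subrr (f s)).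
    by apply: is_deriveB; [exact: HF|exact: dH].
  suff : F t - H t = F 0 - H 0 by lra.
  have [t0'|t0'] := leP 0 t.
  - have [s|c _ ] := @MVT_closed R (fun r => F r - H r)
      (fun=> 0) _ _ t0'; last first.
      by rewrite mul0r => /subr0_eq.
    by move=> /andP[? ?]; apply: D; lra.
  - have [s|c _ ] := @MVT_closed R (fun r => F r - H r)
      (fun=> 0) _ _ (ltW t0'); last first.
      by rewrite mul0r => /subr0_eq.
    by move=> /andP[? ?]; apply: D; lra.
pose P t := if 0 <= t then F t - F 0 else H t - H 0.
have dP (t : R) : is_derive t (1 : R) P (f t).
  have [t0'|t0'] := ltP t 0.
  - have : is_derive t (1 : R) (fun s => H s - H 0) (f t).
      rewrite -[f t]subr0; apply: is_deriveB; apply: dH; lra.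
    apply: near_eq_is_derive.
    near=> s; rewrite /P leNgt.
    have -> // : s < 0.
    by near: s; exact: lt_nbhsl.
  (* When [t] is 0, nearby times may be negative, but they stay in the overlap, where both branches
     agree. *)
  - have : is_derive t (1 : R) (fun s => F s - F 0) (f t).
      rewrite -[f t]subr0; apply: is_deriveB; apply: HF; lra.
    apply: near_eq_is_derive.
    near=> s; rewrite /P.
    have s1 : -1 < s by near: s; apply: lt_nbhsr; lra.
    by case: leP => // s0; rewrite FH//; lra.
exists (fun s => P s - P t0); first by rewrite subrr.
by move=> t; rewrite -[f t]subr0; apply: is_deriveB.
Unshelve. all: by end_near. Qed.

Lemma vector_antiderivative (R : realType) (n : nat) (phi : R -> 'cV[R]_n)
    (t0 : R) : continuous phi ->
  exists2 F : R -> 'cV[R]_n, F t0 = 0 &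
    forall t, is_derive t (1 : R) F (phi t).
Proof.
move=> cphi.
have H (i : 'I_n) : {F : R -> R | F t0 = 0 /\
    forall t, is_derive t (1 : R) F (phi t i 0)}.
  apply: cid; have [|F F0 HF] := @antiderivative R (fun t => phi t i 0) t0.
    move=> t; apply: (@continuous_comp _ _ _ phi (fun A : 'cV_n => A i 0)).
      exact: cphi.
    exact: coord_continuous.
  by exists F.
exists (fun t => \col_i (sval (H i)) t).
  by apply/colP => i; rewrite !mxE; have [] := svalP (H i).
move=> t; apply/is_derive_mxP => i j; rewrite ord1.
under eq_fun do rewrite mxE.
by have [_] := svalP (H i); exact.
Qed.

(** The majorant [a * expR (L * (s - t0))] has the assumed bound as its derivative and is
    nonnegative at [t0], where [F] vanishes; it therefore dominates both [F] and [- F]. *)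
Lemma exp_growth_right (R : realType) (F dF : R -> R) (a L t0 t : R) :
  t0 <= t -> 0 <= a -> F t0 = 0 ->
  (forall s, is_derive s (1 : R) F (dF s)) ->
  (forall s, t0 <= s <= t -> `|dF s| <= a * L * expR (L * (s - t0))) ->
  `|F t| <= a * expR (L * (t - t0)).
Proof.
move=> t0t a0 F0 HF bnd.
have dE (s : R) : is_derive s (1 : R) (fun s => a * expR (L * (s - t0)))
    (a * L * expR (L * (s - t0))).
  have dL : is_derive s (1 : R) (fun s => L * (s - t0)) L.
    rewrite -[X in is_derive _ _ _ X]mulr1 -[X in L * X]subr0.
    by apply: is_deriveZ; apply: is_deriveB.
  have := @is_derive1_comp R expR (fun s => L * (s - t0)) s _ _
    (is_derive_expR _) dL.
  move=> /(@is_deriveZ _ _ _ _ a).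
  by rewrite /GRing.scale/= mulrA mulrAC.
have H (G dG : R -> R) : G t0 = 0 ->
    (forall s, is_derive s (1 : R) G (dG s)) ->
    (forall s, t0 <= s <= t -> dG s <= a * L * expR (L * (s - t0))) ->
    G t <= a * expR (L * (t - t0)).
  move=> G0 HG dGle.
  have : G t - a * expR (L * (t - t0)) <= G t0 - a * expR (L * (t0 - t0)).
    apply: (@derive_le0_le _ (fun s => G s - a * expR (L * (s - t0)))
      (fun s => dG s - a * L * expR (L * (s - t0))) _ _ t0t).
    by move=> s /dGle; rewrite subr_le0.
  by rewrite G0 subrr mulr0 expR0; lra.
rewrite ler_norml; apply/andP; split; last first.
  by apply: (H _ dF) => // s /bnd; rewrite ler_norml => /andP[].
rewrite lerNl; apply: (H (fun s => - F s) (fun s => - dF s)).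
- by rewrite F0 oppr0.
- by move=> s /bnd; rewrite ler_norml lerNl => /andP[].
Qed.

(** In the sup norm weighted by exp(-L|t - t0|), integrating from [t0] gains a factor 1/L; this gain
    is what makes Picard iteration contract. *)
Lemma exp_growth (R : realType) (n : nat) (F dF : R -> 'cV[R]_n)
    (a L t0 t : R) :
  0 <= a -> F t0 = 0 -> (forall s, is_derive s (1 : R) F (dF s)) ->
  (forall s, `|dF s| <= a * L * expR (L * `|s - t0|)) ->
  `|F t| <= a * expR (L * `|t - t0|).
Proof.
move=> a0 F0 HF bnd; apply: mx_norm_le; first by rewrite mulr_ge0// expR_ge0.
move=> i j.
have HFij (s : R) : is_derive s (1 : R) (fun s => F s i j) (dF s i j).
  exact: ((is_derive_mxP _ _ _).1 (HF s)).
have bndij s : `|dF s i j| <= a * L * expR (L * `|s - t0|).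
  exact: le_trans (entry_le_norm _ _ _) (bnd s).
have [tt0|/ltW tt0] := leP t0 t.
  rewrite [`|t - t0|]ger0_norm ?subr_ge0//.
  apply: (@exp_growth_right _ (fun s => F s i j) (fun s => dF s i j)) => //.
    by rewrite F0 mxE.
  by move=> s /andP[ts _]; rewrite -[s - t0]ger0_norm ?subr_ge0.
rewrite [`|t - t0|]ler0_norm ?subr_le0// opprB.
(* Times before [t0] reduce to the forward case for the reflection [- F (- s)], started at
   [- t0]. *)
have -> : t0 - t = - t - - t0 by ring.
have -> : F t i j = - (- F (- (- t)) i j) by rewrite !opprK.
rewrite normrN.
apply: (@exp_growth_right _ (fun s => - F (- s) i j) (fun s => dF (- s) i j)).
- by rewrite lerN2.
- by [].
- by rewrite opprK F0 mxE oppr0.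
- by move=> s; apply: (@is_derive_reflect _ (fun s => F s i j)).
- move=> s /andP[ts _]; have := bndij (- s).
  have -> // : `|- s - t0| = s - - t0.
    by rewrite ler0_norm; [ring|lra].
Qed.

Lemma derive_bounded_lipschitz (R : realType) (n : nat)
    (F dF : R -> 'cV[R]_n) (K : R) :
  (forall s, is_derive s (1 : R) F (dF s)) -> (forall s, `|dF s| <= K) ->
  forall s t, `|F t - F s| <= K * `|t - s|.
Proof.
move=> HF bnd; have K0 : 0 <= K by exact: le_trans (normr_ge0 _) (bnd 0).
move=> s t; wlog st : s t / s <= t.
  move=> H; have [|/ltW ts] := leP s t; first exact: H.
  by rewrite distrC [`|t - s|]distrC; exact: H.
apply: mx_norm_le; first by rewrite mulr_ge0.
move=> i j; have [r _|c _ E] := @MVT_closed _ (fun r => F r i j)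
  (fun r => dF r i j) _ _ st.
  exact: ((is_derive_mxP _ _ _).1 (HF r)).
by rewrite !mxE E normrM ler_wpM2r// (le_trans (entry_le_norm _ _ _)).
Qed.

(** Serves to pass to the limit in estimates for the k-th iterate, whose error is a fixed multiple
    of 2^-k. *)
Lemma le_of_le_add_half_pow (R : realType) (a b c : R) :
  (forall k, a <= b + c * 2^-1 ^+ k) -> a <= b.
Proof.
move=> H; apply/ler_addgt0Pr => e e0.
have : ((fun k => c * 2^-1 ^+ k) : R^nat) @ \oo --> c * 0.
  by apply: cvgMl_tmp; apply: cvg_expr; rewrite gtr0_norm; lra.
rewrite mulr0 => /cvgrPdist_le /(_ _ e0)[N _ /(_ N (leqnn N))] /=.
by rewrite sub0r normrN => /ler_normlW; have := H N; lra.
Qed.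

(* The limit is the supremum of the lower bounds [v k - 2 c / 2^k], which
   increase while staying below the decreasing upper bounds
   [v k + 2 c / 2^k]. *)
Lemma geometric_limit (R : realType) (v : R^nat) (c : R) : 0 <= c ->
  (forall k, `|v k.+1 - v k| <= c * 2^-1 ^+ k) ->
  exists l, forall k, `|l - v k| <= 2 * c * 2^-1 ^+ k.
Proof.
move=> c0 H; pose lo k := v k - 2 * c * 2^-1 ^+ k.
pose hi k := v k + 2 * c * 2^-1 ^+ k.
have loS k : lo k <= lo k.+1.
  by have := H k; rewrite ler_norml /lo exprS; lra.
have hiS k : hi k.+1 <= hi k.
  by have := H k; rewrite ler_norml /hi exprS; lra.
have ndlo : nondecreasing_seq lo by exact/nondecreasing_seqP.
have nihi : nonincreasing_seq hi by exact/nonincreasing_seqP.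
have lohi j k : lo j <= hi k.
  have /le_trans : lo j <= lo (maxn j k) by apply: ndlo; exact: leq_maxl.
  apply; have /(le_trans _) : hi (maxn j k) <= hi k by apply: nihi; exact: leq_maxr.
  apply; have : 0 <= 2 * c * 2^-1 ^+ (maxn j k).
    by rewrite mulr_ge0 ?exprn_ge0//; lra.
  by rewrite /lo /hi; lra.
exists (sup (range lo)) => k.
have supR : has_sup (range lo).
  by split; [exists (lo 0%N), 0%N|exists (hi 0%N) => _ [j _ <-]].
have l1 : lo k <= sup (range lo) by apply: sup_upper_bound => //; exists k.
have l2 : sup (range lo) <= hi k.
  by apply: ge_sup; [exists (lo 0%N), 0%N|move=> _ [j _ <-]].
by rewrite ler_norml; move: l1 l2; rewrite /lo /hi; lra.
Qed.

(** * Picard iteration and uniqueness *)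

Lemma continuous_pair (T U V : topologicalType) (f : T -> U) (g : T -> V) :
  continuous f -> continuous g -> continuous (fun t => (f t, g t)).
Proof.
move=> cf cg t.
have H := @cvg_pair _ _ _ (nbhs t) _ _ _ _ _ f g (cf t) (cg t).
exact: H.
Qed.

Lemma lipschitz_continuous (R : realType) (U W : normedModType R)
    (F : U -> W) (K : R) :
  (forall x y, `|F x - F y| <= K * `|x - y|) -> continuous F.
Proof.
move=> H x; apply/cvgrPdist_le => e e0; near=> y.
apply: (le_trans (H x y)).
(* The constant is enlarged to a positive one, since the sign of [K] is unknown and a division
   follows. *)
have K1 : K < `|K| + 1 by rewrite (le_lt_trans (ler_norm K))// ltrDl.
apply: (@le_trans _ _ ((`|K| + 1) * `|x - y|)).
  by rewrite ler_wpM2r// ltW.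
rewrite -ler_pdivlMl ?ltr_wpDl// mulrC; near: y.
by apply: cvgr_dist_le => //; rewrite divr_gt0 ?ltr_wpDl.
Unshelve. all: by end_near. Qed.

(* Picard iteration: the weight [expR (2 L |t - t0|)] makes the iteration
   contract by [1/2] on the whole line. *)
Theorem global_solution (R : realType) (n : nat)
    (g : R * 'cV[R]_n -> 'cV[R]_n) (K L t0 : R) (x : 'cV[R]_n) :
  continuous g -> 0 < L -> (forall p, `|g p| <= K) ->
  (forall t y z, `|g (t, y) - g (t, z)| <= L * `|y - z|) ->
  exists2 u : R -> 'cV[R]_n, u t0 = x &
    forall t, is_derive t (1 : R) u (g (t, u t)).
Proof.
move=> cg L0 gK gL.
have K0 : 0 <= K by exact: le_trans (normr_ge0 _) (gK (0, 0)).
pose along (w : R -> 'cV[R]_n) t := g (t, w t).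
have along_cont w : continuous w -> continuous (along w).
  move=> cw t; apply: (@continuous_comp _ _ _ (fun t => (t, w t)) g).
    by apply: continuous_pair => // r; exact: cvg_id.
  exact: cg.
have [T HT] : {T : (R -> 'cV[R]_n) -> R -> 'cV[R]_n | forall w, continuous w ->
    T w t0 = x /\ forall t, is_derive t (1 : R) (T w) (along w t)}.
  suff H (w : R -> 'cV[R]_n) : {v : R -> 'cV[R]_n | continuous w ->
      v t0 = x /\ forall t, is_derive t (1 : R) v (along w t)}.
    by exists (fun w => sval (H w)) => w; exact: (svalP (H w)).
  apply: cid; have [/along_cont cw|ncw] := pselect (continuous w); last by exists w.
  have [F F0 HF] := vector_antiderivative t0 cw.
  exists (fun t => x + F t) => _; rewrite F0 addr0; split=> // t.
  by rewrite -[along w t]add0r; apply: is_deriveD; exact: is_derive_cst.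
pose u k := iter k T (fun=> x).
have ucont k : continuous (u k).
  elim: k => [|k IH]; first by move=> t; exact: cvg_cst.
  move=> t; exact: is_derive_continuous ((HT _ IH).2 t).
have duS k t : is_derive t (1 : R) (u k.+1) (along (u k) t).
  exact: (HT _ (ucont k)).2.
have u0 k : u k t0 = x by case: k => // k; exact: (HT _ (ucont k)).1.
(* All iterates share the Lipschitz constant [K]; it survives pointwise limits and so gives the
   continuity of the limit [v]. *)
have uK k s t : `|u k t - u k s| <= K * `|t - s|.
  case: k => [|k]; first by rewrite subrr normr0 mulr_ge0.
  by apply: derive_bounded_lipschitz => // r; exact: gK.
pose E t := expR (2 * L * `|t - t0|).
have E1 t : 1 <= E t.
  by rewrite /E -expR0 ler_expR !mulr_ge0// ltW.
have E0 t : 0 <= E t by exact: expR_ge0.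
(* Chosen so that [C * (2 * L)] is [K], which bounds the derivative of the first increment. *)
pose C := K / (2 * L).
have C0 : 0 <= C by rewrite divr_ge0// mulr_ge0// ltW.
have CL : C * (2 * L) = K by rewrite divfK// mulf_neq0 ?gt_eqF.
have uu k l : u k t0 = u l t0 by rewrite !u0.
have p0 k : 0 <= 2^-1 ^+ k :> R by rewrite exprn_ge0// invr_ge0.
have stepE (v w : R -> 'cV[R]_n) (a : R) : 0 <= a -> v t0 = w t0 ->
    forall dv dw : R -> 'cV[R]_n, (forall t, is_derive t (1 : R) v (dv t)) ->
    (forall t, is_derive t (1 : R) w (dw t)) ->
    (forall t, `|dv t - dw t| <= a * (2 * L) * E t) ->
    forall t, `|v t - w t| <= a * E t.
  move=> a0 vw dv dw dv' dw' H t.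
  apply: (@exp_growth _ _ (fun t => v t - w t) (fun t => dv t - dw t)) => //.
  by rewrite vw subrr.
have ustep k t : `|u k.+1 t - u k t| <= C * E t * 2^-1 ^+ k.
  elim: k t => [|k IH] t.
    rewrite expr0 mulr1; apply: (stepE (u 1%N) (u 0%N) _ C0 (uu _ _)
      (along (u 0%N)) (fun=> 0) (duS 0%N) (fun r => is_derive_cst x r 1)).
    move=> s; rewrite subr0 CL; apply: le_trans (gK _) _.
    by rewrite ler_peMr.
  have Cp : 0 <= C * 2^-1 ^+ k.+1 by exact: mulr_ge0.
  rewrite mulrAC.
  apply: (stepE (u k.+2) (u k.+1) _ Cp (uu _ _) _ _ (duS k.+1) (duS k)) => s.
  (* The Lipschitz bound costs a factor L and [stepE] divides by 2 L, which leaves the ratio 1/2. *)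
  apply: le_trans (gL _ _ _) _.
  rewrite (_ : _ * E s = L * (C * E s * 2^-1 ^+ k)); first by rewrite ler_pM2l.
  by rewrite exprS; field.
have [v Hv] : {v : R -> 'cV[R]_n |
    forall k t, `|v t - u k t| <= 2 * C * E t * 2^-1 ^+ k}.
  have H t i : {l : R | forall k, `|l - u k t i 0| <= 2 * (C * E t) * 2^-1 ^+ k}.
    apply: cid; apply: geometric_limit => [|k]; first by rewrite mulr_ge0.
    apply: le_trans (ustep k t).
    by rewrite (le_trans _ (entry_le_norm _ i 0))// !mxE.
  exists (fun t => \col_i sval (H t i)) => k t; apply: mx_norm_le.
    by rewrite mulr_ge0// mulr_ge0// mulr_ge0.
  by move=> i j; rewrite ord1 !mxE -[2 * C * E t]mulrA; exact: (svalP (H t i)).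
have vK s t : `|v s - v t| <= K * `|s - t|.
  apply: (@le_of_le_add_half_pow _ _ _ (2 * C * E s + 2 * C * E t)) => k.
  have -> : v s - v t = (v s - u k s) + (u k s - u k t) - (v t - u k t).
    by rewrite opprB !subrKA.
  have := Hv k s; have := Hv k t; have := uK k t s.
  have := ler_normB (v s - u k s + (u k s - u k t)) (v t - u k t).
  have := ler_normD (v s - u k s) (u k s - u k t).
  by rewrite mulrDl; lra.
have cv : continuous v by exact: lipschitz_continuous vK.
have [Tv0 dTv] := HT _ cv.
suff Tvv : T v = v.
  exists v; first by rewrite -[in LHS]Tvv.
  by move=> t; have := dTv t; rewrite Tvv.
apply/funext => t; apply/eqP; rewrite -subr_eq0 -normr_le0.
(* Both [T v t] and [v t] lie within [C * E t] / 2^k of the iterate [u k.+1 t]; the factor 3 in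
   place of 2 is slack. *)
apply: (@le_of_le_add_half_pow _ _ _ (3 * C * E t)) => k; rewrite add0r.
have Tu : `|T v t - u k.+1 t| <= C * 2^-1 ^+ k * E t.
  have Cp : 0 <= C * 2^-1 ^+ k by exact: mulr_ge0.
  have Tu0 : T v t0 = u k.+1 t0 by rewrite Tv0 u0.
  apply: (stepE (T v) (u k.+1) _ Cp Tu0 _ _ dTv (duS k)) => s.
  apply: le_trans (gL _ _ _) _.
  rewrite (_ : _ * E s = L * (2 * C * E s * 2^-1 ^+ k)); last by ring.
  by rewrite ler_pM2l.
have -> : T v t - v t = (T v t - u k.+1 t) - (v t - u k.+1 t).
  by rewrite opprB subrKA.
have := ler_normB (T v t - u k.+1 t) (v t - u k.+1 t).
have := Hv k.+1 t; rewrite exprS.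
have -> : 3 * C * E t * 2^-1 ^+ k =
  C * 2^-1 ^+ k * E t + 2 * C * E t * 2^-1 ^+ k by ring.
have -> : 2 * C * E t * (2^-1 * 2^-1 ^+ k) = C * E t * 2^-1 ^+ k by field.
have : 0 <= C * E t * 2^-1 ^+ k by rewrite mulr_ge0// mulr_ge0.
by lra.
Qed.

(** The max norm is not differentiable, so the sum of squares [E] of the entries of the difference
    is used: [E] times a decaying exponential is nonincreasing and starts at 0. The Lipschitz bound
    is asked only along the two curves, so a local constant will do. *)
Lemma gronwall_unique (R : realType) (n : nat) (u v du dv : R -> 'cV[R]_n)
    (a b L : R) : a <= b -> u a = v a ->
  (forall s, a <= s <= b -> is_derive s (1 : R) u (du s)) ->
  (forall s, a <= s <= b -> is_derive s (1 : R) v (dv s)) ->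
  (forall s, a <= s <= b -> `|du s - dv s| <= L * `|u s - v s|) ->
  u b = v b.
Proof.
move=> ab uva Hu Hv bnd.
pose w i s := u s i 0 - v s i 0; pose dw i s := du s i 0 - dv s i 0.
pose E s := \sum_i w i s ^+ 2; pose dE s := \sum_i 2 * (w i s * dw i s).
(* Each of the n terms of [dE] is at most 2 |L| [E]; the absolute value covers an [L] of unknown
   sign. *)
pose c := 2 * n%:R * `|L|.
have dw' i s : a <= s <= b -> is_derive s (1 : R) (w i) (dw i s).
  move=> sab; apply: is_deriveB.
    exact: ((is_derive_mxP _ _ _).1 (Hu s sab)).
  exact: ((is_derive_mxP _ _ _).1 (Hv s sab)).
have dE' s : a <= s <= b -> is_derive s (1 : R) E (dE s).
  move=> sab; rewrite (_ : E = \sum_i (fun s => w i s ^+ 2)); last first.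
    by apply/funext => r; rewrite fct_sumE.
  apply: is_derive_sum => i.
  have H := is_deriveM (dw' i s sab) (dw' i s sab).
  by apply: (is_derive_eq H); rewrite /GRing.scale/=; ring.
have E0 s : 0 <= E s by apply: sumr_ge0 => i _; exact: sqr_ge0.
have wE s : `|u s - v s| ^+ 2 <= E s.
  (* A nonzero max norm is attained at some entry, whose square is one of the terms of [E]. *)
  have [->|/mx_norm_neq0[[i j] /=]] := eqVneq `|u s - v s| 0.
    by rewrite expr0n.
  rewrite -[mx_norm _]/(`|u s - v s|) => ->.
  rewrite !mxE ord1 real_normK ?num_real// /E (bigD1 i)//= lerDl.
  by apply: sumr_ge0 => k _; exact: sqr_ge0.
have dEc s : a <= s <= b -> dE s <= c * E s.
  move=> sab; have : dE s <= \sum_(i < n) 2 * (`|L| * E s).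
    apply: ler_sum => i _; rewrite ler_pM2l//.
    apply: le_trans (ler_norm _) _; rewrite normrM.
    have wi : `|w i s| <= `|u s - v s|.
      by apply: le_trans (entry_le_norm _ i 0); rewrite !mxE.
    have dwi : `|dw i s| <= `|L| * `|u s - v s|.
      have : `|dw i s| <= `|du s - dv s|.
        by apply: le_trans (entry_le_norm _ i 0); rewrite !mxE.
      move=> /le_trans; apply; apply: le_trans (bnd _ sab) _.
      by rewrite ler_wpM2r// ler_norm.
    apply: le_trans (ler_pM _ _ wi dwi) _ => //.
    by rewrite mulrCA -expr2 ler_wpM2l.
  rewrite sumr_const card_ord -mulr_natl /c => /le_trans; apply.
  by rewrite le_eqVlt; apply/orP; left; apply/eqP; ring.
pose G s := E s * expR (- (c * (s - a))).
have Ga : G a = 0.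
  rewrite /G /E big1 ?mul0r// => i _.
  by rewrite /w uva subrr expr0n.
have : G b <= G a.
  apply: (@derive_le0_le _ G
    (fun s => (dE s - c * E s) * expR (- (c * (s - a)))) _ _ ab) => s sab.
    have dl : is_derive s (1 : R) (fun s => - (c * (s - a))) (- c).
      rewrite -[X in is_derive _ _ _ (- X)]mulr1 -[X in - (c * X)]subr0.
      by apply: is_deriveN; apply: is_deriveZ; apply: is_deriveB.
    have de := @is_derive1_comp R expR (fun s => - (c * (s - a))) s _ _
      (is_derive_expR _) dl.
    have := is_deriveM (dE' s sab) de.
    rewrite /GRing.scale/= => H; apply: (is_derive_eq H) => /=; ring.
  by rewrite mulr_le0_ge0 ?expR_ge0// subr_le0 dEc.
rewrite Ga /G pmulr_lle0 ?expR_gt0// => Eb.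
have : `|u b - v b| ^+ 2 <= 0 by exact: le_trans (wE b) Eb.
by rewrite exprn_even_le0//= normr_eq0 subr_eq0 => /eqP.
Qed.

(** * Local Lipschitz estimate for smooth fields *)

(** For the max norm it suffices to apply the scalar mean value theorem to each entry, with an
    intermediate point of its own. *)
Lemma mean_value_le (R : realType) (n : nat) (F dF : R -> 'cV[R]_n)
    (K a b : R) : 0 <= K -> a <= b ->
  (forall s, a <= s <= b -> is_derive s (1 : R) F (dF s)) ->
  (forall s, a <= s <= b -> `|dF s| <= K) ->
  `|F b - F a| <= K * (b - a).
Proof.
move=> K0 ab HF bnd; apply: mx_norm_le; first by rewrite mulr_ge0 ?subr_ge0.
move=> i j; have [r rab|c cab E] := @MVT_closed _ (fun r => F r i j)
  (fun r => dF r i j) _ _ ab.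
  exact: ((is_derive_mxP _ _ _).1 (HF r rab)).
rewrite !mxE E normrM [`|b - a|]ger0_norm ?subr_ge0// ler_wpM2r ?subr_ge0//.
exact: le_trans (entry_le_norm _ _ _) (bnd c cab).
Qed.

Lemma norm_trmx (R : realType) (m n : nat) (A : 'M[R]_(m, n)) : `|A^T| = `|A|.
Proof.
apply/eqP; rewrite eq_le; apply/andP; split; apply: mx_norm_le => // i j.
  by rewrite mxE entry_le_norm.
by have := entry_le_norm A^T j i; rewrite mxE.
Qed.

Lemma closed_norm_ball (R : realType) (W : normedModType R) (r : R) :
  closed [set x : W | `|x| <= r].
Proof.
apply: (@preimage_closed _ _ (@Num.norm R W) [set z : R | z <= r]).
  by move=> x _; exact: norm_continuous.
exact: closed_le.
Qed.

(** Heine-Borel is applied to row vectors and carried over by transposition, which is an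
    isometry. *)
Lemma compact_norm_ball (R : realType) (n : nat) (r : R) :
  compact [set x : 'cV[R]_n | `|x| <= r].
Proof.
have -> : [set x : 'cV[R]_n | `|x| <= r] = trmx @` [set y : 'rV[R]_n | `|y| <= r].
  apply/seteqP; split => [x /= xr|_ /= [y yr <-]]; last by rewrite norm_trmx.
  by exists x^T; rewrite ?trmxK ?norm_trmx.
apply: continuous_compact.
  apply: continuous_subspaceT; apply: (@lipschitz_continuous _ _ _ _ 1) => x y.
  by rewrite mul1r -linearB norm_trmx.
apply: bounded_closed_compact; last exact: closed_norm_ball.
exists r; split; first exact: num_real.
by move=> M rM x /= /le_trans; apply; exact: ltW.
Qed.

Lemma compact_box (R : realType) (n : nat) (r : R) :
  compact [set p : R * 'cV[R]_n | `|p.1| <= r /\ `|p.2| <= r].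
Proof.
have -> : [set p : R * 'cV[R]_n | `|p.1| <= r /\ `|p.2| <= r] =
    `[- r, r] `*` [set x : 'cV[R]_n | `|x| <= r].
  by apply/seteqP; split => p /=; rewrite in_itv/= ler_norml.
by apply: compact_setX; [exact: segment_compact|exact: compact_norm_ball].
Qed.

Lemma continuous_compact_norm_bound (R : realType) (U W : normedModType R)
    (F : U -> W) (A : set U) : continuous F -> compact A ->
  exists C, forall p, A p -> `|F p| <= C.
Proof.
move=> cF cA.
have [C [_ HC]] :=
  compact_bounded (continuous_compact (continuous_subspaceT cF) cA).
exists (C + 1) => p Ap; apply: (HC (C + 1)); first by rewrite ltrDl.
by exists p.
Qed.

Lemma is_derive_line (R : realType) (n : nat) (f : R * 'cV[R]_n -> 'cV[R]_n)
    (t tau : R) (y d : 'cV[R]_n) : differentiable f (t, y + tau *: d) ->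
  is_derive tau (1 : R) (fun s => f (t, y + s *: d))
    ('D_(0, d) f (t, y + tau *: d)).
Proof.
move=> /(@diff_derivable _ _ _ f _ (0, d)) df.
have E : (fun h : R => h^-1 *: ((fun s => f (t, y + s *: d)) (h *: 1 + tau) -
      f (t, y + tau *: d))) =
    (fun h : R => h^-1 *: (f (h *: (0, d) + (t, y + tau *: d)) -
      f (t, y + tau *: d))).
  apply/funext => h; congr (_ *: (f _ - _)).
  congr (_, _); first by rewrite /= scaler0 add0r.
  by rewrite /= scalerDl [h *: 1]mulr1 [RHS]addrCA.
by apply: DeriveDef; rewrite /derivable /derive /= E.
Qed.

(** Smoothness gives continuity of the derivative in each fixed direction; expanding [d] in the
    basis reduces all state directions to n of them, which can be bounded on a compact set
    together. *)
Lemma diff_coord_le (R : realType) (n : nat) (f : R * 'cV[R]_n -> 'cV[R]_n)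
    (p : R * 'cV[R]_n) (d : 'cV[R]_n) : differentiable f p ->
  `|'D_(0, d) f p| <= (\sum_j `|'D_(0, delta_mx j 0) f p|) * `|d|.
Proof.
move=> dfp; rewrite deriveE//.
have -> : (0, d) = \sum_j d j 0 *: (0, delta_mx j 0) :> R * 'cV[R]_n.
  rewrite [RHS]surjective_pairing; congr pair.
    rewrite (big_morph fst (id1 := 0) (op1 := +%R))//.
    by rewrite big1// => j _; rewrite /= scaler0.
  rewrite (big_morph snd (id1 := 0) (op1 := +%R))//=.
  rewrite {1}[d]matrix_sum_delta; apply: eq_bigr => i _.
  by rewrite big_ord1.
rewrite linear_sum mulr_suml; apply: le_trans (ler_norm_sum _ _ _) _.
apply: ler_sum => j _; rewrite linearZ/= normrZ deriveE// mulrC.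
by rewrite ler_wpM2l// entry_le_norm.
Qed.

(** The coordinate derivatives are bounded on the compact box, and the box contains the segment from
    [y] to [x], along which the mean value inequality applies. *)
Lemma smooth_lipschitz_box (R : realType) (n : nat)
    (f : R * 'cV[R]_n -> 'cV[R]_n) (r : R) : smooth f ->
  exists2 L, 0 < L & forall t x y, `|t| <= r -> `|x| <= r -> `|y| <= r ->
    `|f (t, x) - f (t, y)| <= L * `|x - y|.
Proof.
move=> fsmooth; have [df cdf] := fsmooth 1%N.
pose box := [set p : R * 'cV[R]_n | `|p.1| <= r /\ `|p.2| <= r].
have H (j : 'I_n) : {C | forall p, box p -> `|'D_(0, delta_mx j 0) f p| <= C}.
  apply: cid; apply: continuous_compact_norm_bound; last exact: compact_box.
  exact: cdf.
pose L := \sum_j `|sval (H j)|.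
have L0 : 0 <= L by apply: sumr_ge0.
(* The sum [L] may vanish, for instance when [f] does not depend on the state; adding 1 makes it
   positive. *)
exists (L + 1); first by rewrite ltr_wpDl.
move=> t x y tr xr yr.
have seg s : 0 <= s <= 1 -> `|y + s *: (x - y)| <= r.
  move=> /andP[s0 s1]; rewrite (_ : _ + _ = (1 - s) *: y + s *: x); last first.
    by rewrite scalerBr scalerBl scale1r [s *: x - _]addrC addrA.
  apply: le_trans (ler_normD _ _) _; rewrite !normrZ.
  rewrite [`|s|]ger0_norm// [`|1 - s|]ger0_norm ?subr_ge0//.
  rewrite [leRHS](_ : r = (1 - s) * r + s * r); last by ring.
  by apply: lerD; rewrite ler_wpM2l// subr_ge0.
apply: (@le_trans _ _ (L * `|x - y|)); last by rewrite ler_wpM2r// lerDl.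
have K0 : 0 <= L * `|x - y| by rewrite mulr_ge0.
have := mean_value_le K0 (ler01 : 0 <= 1 :> R)
  (fun s _ => @is_derive_line _ _ f t s y (x - y) (df _)).
rewrite scale1r scale0r addr0 [y + _]addrC subrK subr0 mulr1; apply.
move=> s s01; apply: le_trans (diff_coord_le _ (df _)) _.
rewrite ler_wpM2r//; apply: ler_sum => j _.
have /le_trans : `|'D_(0, delta_mx j 0) f (t, y + s *: (x - y))| <= sval (H j).
  by apply: (svalP (H j)); split => //=; exact: seg.
by apply; exact: ler_norm.
Qed.

(** * The norm of a positive definite matrix *)

Lemma dist_max_le (R : realDomainType) (r a b : R) :
  `|Num.max r a - Num.max r b| <= `|a - b|.
Proof.
have := ler_norm (a - b); have := ler_norm (b - a); rewrite (distrC b a).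
by rewrite ler_norml; case: (leP r a); case: (leP r b); lra.
Qed.

Section quadratic_norm.
Variables (R : realType) (n : nat) (M : 'M[R]_n).
Hypothesis Mspd : spd M.
Implicit Types x y z : 'cV[R]_n.

Definition bform x y : R := (x^T *m M *m y) 0 0.

Lemma bformDl x y z : bform (x + y) z = bform x z + bform y z.
Proof. by rewrite /bform linearD/= !mulmxDl mxE. Qed.

Lemma bformZl a x y : bform (a *: x) y = a * bform x y.
Proof. by rewrite /bform linearZ/= -!scalemxAl mxE. Qed.

Lemma bformBr x y z : bform x (y - z) = bform x y - bform x z.
Proof. by rewrite /bform mulmxBr !mxE. Qed.

Lemma bformC x y : bform x y = bform y x.
Proof.
rewrite /bform -[in LHS](trmxK (x^T *m M *m y)) mxE !trmx_mul trmxK.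
by rewrite (proj1 Mspd) mulmxA.
Qed.

Lemma bform_ge0 x : 0 <= bform x x.
Proof.
have [->|x0] := eqVneq x 0; last exact/ltW/(proj2 Mspd).
by rewrite /bform mulmx0 mxE.
Qed.

Lemma mnorm_ge0 x : 0 <= mnorm M x.
Proof. exact: sqrtr_ge0. Qed.

Lemma mnorm_sqr x : mnorm M x ^+ 2 = bform x x.
Proof. by rewrite sqr_sqrtr// bform_ge0. Qed.

Lemma mnorm_gt0 x : x != 0 -> 0 < mnorm M x.
Proof. by move=> x0; rewrite sqrtr_gt0; exact: (proj2 Mspd). Qed.

Lemma mnormZ a x : mnorm M (a *: x) = `|a| * mnorm M x.
Proof.
rewrite /mnorm -/(bform _ _) bformZl bformC bformZl mulrA -expr2.
by rewrite sqrtrM ?sqr_ge0// sqrtr_sqr.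
Qed.

Lemma mnorm0 : mnorm M 0 = 0.
Proof. by rewrite -(scale0r 0) mnormZ normr0 mul0r. Qed.

Lemma mnormN x : mnorm M (- x) = mnorm M x.
Proof. by rewrite -scaleN1r mnormZ normrN1 mul1r. Qed.

Lemma mnorm_distC x y : mnorm M (x - y) = mnorm M (y - x).
Proof. by rewrite -mnormN opprB. Qed.

(** Cauchy-Schwarz inequality, from the nonnegativity of the form at [b *: x - B *: y], where it
    equals [b * (bform x x * b - B ^+ 2)]. *)
Lemma bform_le x y : bform x y <= mnorm M x * mnorm M y.
Proof.
have [->|y0] := eqVneq y 0; first by rewrite /bform mulmx0 mxE mnorm0 mulr0.
apply: le_trans (ler_norm _) _.
rewrite -ler_sqr ?nnegrE ?mulr_ge0 ?mnorm_ge0// exprMn !mnorm_sqr.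
rewrite real_normK ?num_real//.
set b := bform y y; set B := bform x y.
have b0 : 0 < b by exact: (proj2 Mspd).
have := bform_ge0 (b *: x - B *: y).
rewrite bformDl -scaleNr !bformZl (bformC x) (bformC y) !bformDl !bformZl.
rewrite (bformC y x) -/b -/B (_ : _ + _ = b * (bform x x * b - B ^+ 2)).
  by rewrite pmulr_rge0// subr_ge0.
by ring.
Qed.

Lemma mnormD x y : mnorm M (x + y) <= mnorm M x + mnorm M y.
Proof.
rewrite -ler_sqr ?nnegrE ?addr_ge0 ?mnorm_ge0// sqrrD !mnorm_sqr.
rewrite bformDl !(bformC _ (x + y)) !bformDl (bformC y x).
by have := bform_le x y; lra.
Qed.

Lemma mnorm_le_norm : exists2 C, 0 < C & forall x, mnorm M x <= C * `|x|.
Proof.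
(* The form is at most the sum of the |M j i| times |x|^2; the added 1 gives C <= C^2, which avoids
   a square root. *)
pose C := 1 + \sum_i \sum_j `|M j i|.
have S0 : 0 <= \sum_i \sum_j `|M j i|.
  by apply: sumr_ge0 => i _; apply: sumr_ge0.
have C1 : 1 <= C by rewrite lerDl.
exists C => [|x]; first by rewrite (lt_le_trans ltr01).
have Cx0 : 0 <= C * `|x| by rewrite mulr_ge0// (le_trans ler01).
rewrite -ler_sqr ?nnegrE ?mnorm_ge0//.
rewrite mnorm_sqr exprMn; apply: (@le_trans _ _ (C * `|x| ^+ 2)); last first.
  rewrite ler_wpM2r ?sqr_ge0// expr2 ler_peMl//; exact: le_trans ler01 C1.
rewrite mulrDl; apply: ler_wpDl; first by rewrite mul1r sqr_ge0.
rewrite mulr_suml /bform mxE; apply: ler_sum => i _.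
rewrite mxE !mulr_suml; apply: ler_sum => j _; rewrite mxE.
apply: le_trans (ler_norm _) _; rewrite !normrM [`|x j 0| * _]mulrC -mulrA.
by rewrite ler_wpM2l// expr2 ler_pM// entry_le_norm.
Qed.

Lemma mnorm_dist x y : `|mnorm M x - mnorm M y| <= mnorm M (x - y).
Proof.
have := mnormD (x - y) y; rewrite subrK => H1.
have := mnormD (y - x) x; rewrite subrK mnorm_distC => H2.
by rewrite ler_norml; apply/andP; split; lra.
Qed.

Lemma mnorm_continuous : continuous (mnorm M).
Proof.
have [C C0 HC] := mnorm_le_norm.
by apply: (@lipschitz_continuous _ _ _ _ C) => x y;
  exact: le_trans (mnorm_dist x y) (HC _).
Qed.

(** On the compact unit sphere of the max norm, [mnorm M] attains a minimum, positive by
    definiteness; homogeneity does the rest. *)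
Lemma norm_le_mnorm : exists2 c, 0 < c & forall x, `|x| <= c * mnorm M x.
Proof.
pose S := [set x : 'cV[R]_n | `|x| = 1].
have cS : compact S.
  apply: subclosed_compact (@compact_norm_ball R n 1) _; last by move=> x /= ->.
  apply: (@preimage_closed _ _ (@Num.norm R 'cV[R]_n) [set 1]).
    by move=> x _; exact: norm_continuous.
  exact: closed_eq.
have unit x : x != 0 -> S (`|x|^-1 *: x).
  move=> x0; rewrite /S/= normrZ normfV normr_id mulVf//.
  by rewrite normr_eq0.
(* An empty sphere means that 0 is the only vector, and the constant 1 serves. *)
have [S0|/nonemptyPn S0] := pselect (S !=set0); last first.
  exists 1 => // x; have [->|/unit] := eqVneq x 0; last by rewrite S0.
  by rewrite normr0 mul1r mnorm_ge0.
have [x1 /set_mem x1S minx1] :=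
  compact_EVT_min S0 cS (continuous_subspaceT mnorm_continuous).
have m0 : 0 < mnorm M x1.
  by apply: mnorm_gt0; apply: contra_eq_neq x1S => ->;
    rewrite normr0 eq_sym oner_neq0.
exists (mnorm M x1)^-1 => [|x]; first by rewrite invr_gt0.
have [->|x0] := eqVneq x 0; first by rewrite normr0 mulr_ge0 ?invr_ge0 ?mnorm_ge0.
have := minx1 _ (mem_set (unit _ x0)).
rewrite mnormZ normfV normr_id mulrC ler_pdivlMr ?normr_gt0//.
by rewrite -ler_pdivlMl.
Qed.

(** Pairing [F] with its increment [z] reduces to the scalar mean value theorem, and Cauchy-Schwarz
    then allows one factor [mnorm M z] to be cancelled. Unlike an entrywise estimate, this keeps the
    constant [K] exact in the M-norm. *)
Lemma mnorm_mean_value (F dF : R -> 'cV[R]_n) (K a b : R) : a <= b ->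
  (forall s, a <= s <= b -> is_derive s (1 : R) F (dF s)) ->
  (forall s, a <= s <= b -> mnorm M (dF s) <= K) ->
  mnorm M (F b - F a) <= K * (b - a).
Proof.
move=> ab HF bnd; set z := F b - F a.
have K0 : 0 <= K.
  by apply: le_trans (mnorm_ge0 (dF a)) (bnd a _); rewrite lexx.
have [s sab|c cab] := @MVT_closed _ (fun s => bform z (F s))
    (fun s => bform z (dF s)) _ _ ab.
  rewrite /bform (_ : (fun _ => _) =
    \sum_j (fun s => (z^T *m M) 0 j *: F s j 0)); last first.
    by apply/funext => r; rewrite fct_sumE mxE.
  rewrite mxE; apply: is_derive_sum => j; apply: is_deriveZ.
  exact: ((is_derive_mxP _ _ _).1 (HF s sab)).
have -> : bform z (F b) - bform z (F a) = mnorm M z ^+ 2.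
  by rewrite mnorm_sqr -bformBr.
have [z0 _|zn0 E] := eqVneq z 0.
  by rewrite z0 mnorm0 mulr_ge0// subr_ge0.
have : mnorm M z ^+ 2 <= mnorm M z * (K * (b - a)).
  rewrite E mulrA ler_wpM2r ?subr_ge0//; apply: le_trans (bform_le _ _) _.
  by rewrite ler_wpM2l ?mnorm_ge0// bnd.
by rewrite expr2 ler_pM2l// mnorm_gt0.
Qed.

Variables (x0 : 'cV[R]_n) (r : R).
Hypothesis r0 : 0 < r.

(** The maximum in the denominator treats points inside and outside the ball by one formula. *)
Definition retract x := x0 + (r / Num.max r (mnorm M (x - x0))) *: (x - x0).

Lemma max_gt0 x : 0 < Num.max r (mnorm M x).
Proof. by rewrite lt_max r0. Qed.

Lemma retract_in x : mball M x0 r (retract x).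
Proof.
rewrite /mball/= /retract [x0 + _]addrC addrK mnormZ ger0_norm; last first.
  by rewrite divr_ge0// ltW// max_gt0.
by rewrite mulrAC ler_pdivrMr ?max_gt0// ler_pM2l// le_max lexx orbT.
Qed.

Lemma retract_id x : mball M x0 r x -> retract x = x.
Proof.
by rewrite /mball/= /retract => /max_l ->;
  rewrite divff ?gt_eqF// scale1r addrC subrK.
Qed.

(** With the centre moved to 0, the difference splits into [(r / mx) *: (x - y)] and a multiple of
    [y] with coefficient [(r / mx) * ((my - mx) / my)]. Here |my - mx| <= C |x - y|, and |y| / my <=
    c by equivalence of the norms. *)
Lemma retract_lipschitz :
  exists2 L, 0 < L & forall x y, `|retract x - retract y| <= L * `|x - y|.
Proof.
have [C C0 HC] := mnorm_le_norm; have [c c0 Hc] := norm_le_mnorm.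
exists (1 + C * c) => [|x y].
  by rewrite addr_gt0// mulr_gt0.
rewrite /retract opprD addrACA subrr add0r.
have -> : x - y = (x - x0) - (y - x0) by rewrite opprB subrKA.
move: (x - x0) (y - x0) => {}x {}y.
set mx := Num.max r (mnorm M x); set my := Num.max r (mnorm M y).
have mx0 : 0 < mx by exact: max_gt0.
have my0 : 0 < my by exact: max_gt0.
have rmx : r <= mx by rewrite le_max lexx.
have q1 : `|r / mx| <= 1.
  by rewrite ger0_norm ?ler_pdivrMr ?mul1r//; apply: divr_ge0; exact: ltW.
have -> : (r / mx) *: x - (r / my) *: y =
    (r / mx) *: (x - y) + (r / mx - r / my) *: y.
  by rewrite scalerBr scalerBl addrA subrK.
apply: le_trans (ler_normD _ _) _.
rewrite mulrDl (normrZ (r / mx)) (normrZ (r / mx - r / my)).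
apply: lerD; first by exact: ler_wpM2r.
have mxy : `|my - mx| <= C * `|x - y|.
  have : `|my - mx| <= `|mnorm M x - mnorm M y|.
    by rewrite distrC; exact: dist_max_le.
  move=> /le_trans; apply; exact: le_trans (mnorm_dist x y) (HC _).
have -> : r / mx - r / my = (r / mx) * ((my - mx) / my) by field; rewrite !gt_eqF.
rewrite normrM -[leRHS]mul1r -[leLHS]mulrA; apply: ler_pM => //.
rewrite normrM normfV [`|my|]gtr0_norm// -[leLHS]mulrA [leRHS]mulrAC.
apply: ler_pM => //; first by rewrite mulr_ge0// invr_ge0 ltW.
rewrite mulrC ler_pdivrMr//; apply: le_trans (Hc y) _.
by rewrite ler_pM2l// le_max lexx orbT.
Qed.

End quadratic_norm.

(** * Truncated fields *)

Definition clamp (R : realType) (a b t : R) : R := Num.max a (Num.min b t).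

Lemma clamp_in (R : realType) (a b t : R) : a <= b -> a <= clamp a b t <= b.
Proof. by move=> ab; rewrite /clamp le_max lexx/= ge_max ab ge_min lexx. Qed.

Lemma clamp_id (R : realType) (a b t : R) : a <= t <= b -> clamp a b t = t.
Proof. by move=> /andP[at_ tb]; rewrite /clamp (min_r tb) (max_r at_). Qed.

Lemma clamp_continuous (R : realType) (a b : R) : continuous (clamp a b).
Proof.
move=> t; apply: continuous_max; first exact: cst_continuous.
by apply: continuous_min; [exact: cst_continuous|exact: cvg_id].
Qed.

Definition truncation (R : realType) (n : nat) (f : R * 'cV[R]_n -> 'cV[R]_n)
    (M : 'M[R]_n) (a b : R) (x0 : 'cV[R]_n) (r : R) (p : R * 'cV[R]_n) :=
  f (clamp a b p.1, retract M x0 r p.2).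

Lemma mball_norm_le (R : realType) (n : nat) (M : 'M[R]_n) (x0 : 'cV[R]_n)
    (r : R) : spd M ->
  exists rho, forall x, mball M x0 r x -> `|x| <= rho.
Proof.
move=> Mspd; have [c c0 Hc] := norm_le_mnorm Mspd.
exists (c * r + `|x0|) => x; rewrite /mball/= => xr.
rewrite -[x in leLHS](subrK x0); apply: le_trans (ler_normD _ _) _.
by rewrite lerD2r; apply: le_trans (Hc _) _; rewrite ler_pM2l.
Qed.

Section truncation.
Variables (R : realType) (n : nat) (f : R * 'cV[R]_n -> 'cV[R]_n).
Variables (M : 'M[R]_n) (a b : R) (x0 : 'cV[R]_n) (r : R).
Hypotheses (fsmooth : smooth f) (Mspd : spd M) (ab : a <= b) (r0 : 0 < r).

Lemma truncation_box : exists rho, forall t x,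
  `|clamp a b t| <= rho /\ `|retract M x0 r x| <= rho.
Proof.
have [rho Hrho] := mball_norm_le x0 r Mspd.
exists (Num.max (`|a| + `|b|) rho) => t x; split; rewrite le_max; last first.
  by rewrite Hrho ?orbT//; exact: retract_in.
apply/orP; left; have /andP[] := clamp_in t ab.
have := ler_norm b; have := ler_norm (- a); rewrite normrN.
have := normr_ge0 a; have := normr_ge0 b.
by move=> *; rewrite ler_norml; lra.
Qed.

(** The truncation evaluates [f] only inside one fixed box, so the local Lipschitz constant of [f]
    there becomes a global one. *)
Lemma truncation_lipschitz : exists2 L, 0 < L & forall t x y,
  `|truncation f M a b x0 r (t, x) - truncation f M a b x0 r (t, y)| <=
  L * `|x - y|.
Proof.
have [rho Hrho] := truncation_box.
have [L1 L10 HL1] := smooth_lipschitz_box rho fsmooth.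
have [L2 L20 HL2] := retract_lipschitz Mspd x0 r0.
exists (L1 * L2) => [|t x y]; first exact: mulr_gt0.
have [tr xr] := Hrho t x; have [_ yr] := Hrho t y.
apply: le_trans (HL1 _ _ _ tr xr yr) _.
by rewrite -mulrA ler_pM2l.
Qed.

Lemma truncation_solution (t0 : R) (x : 'cV[R]_n) :
  exists2 u : R -> 'cV[R]_n, u t0 = x &
    forall t, is_derive t (1 : R) u (truncation f M a b x0 r (t, u t)).
Proof.
have cf : continuous f := fsmooth 0%N.
have [rho Hrho] := truncation_box.
have [K HK] := continuous_compact_norm_bound cf (@compact_box R n rho).
have [L L0 HL] := truncation_lipschitz.
have [L2 L20 HL2] := retract_lipschitz Mspd x0 r0.
have bg p : `|truncation f M a b x0 r p| <= K by apply: HK => /=; exact: Hrho.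
suff cg : continuous (truncation f M a b x0 r).
  exact: (global_solution t0 x cg L0 bg HL).
move=> p; apply: continuous_comp; last exact: cf.
apply: (@continuous_pair _ _ _ (fun p : R * 'cV[R]_n => clamp a b p.1)
  (fun p : R * 'cV[R]_n => retract M x0 r p.2)) => {}p.
  by apply: continuous_comp; [exact: cvg_fst|exact: clamp_continuous].
apply: continuous_comp; first exact: cvg_snd.
exact: lipschitz_continuous HL2 _.
Qed.

End truncation.

(** * Maximum over the ball, uniqueness and confinement of solutions *)

(** By the extreme value theorem the set has a greatest element, so [maximum] does not fall back on
    its default 0. *)
Lemma maximum_ubound (R : realType) (T : topologicalType) (F : T -> R)
    (A : set T) : compact A -> A !=set0 -> continuous F ->
  ubound (F @` A) (maximum (F @` A)).
Proof.
move=> cA A0 cF.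
have [c /set_mem Ac Fc] := compact_EVT_max A0 cA (continuous_subspaceT cF).
have : exists m, is_maximum (F @` A) m.
  by exists (F c); split; [exists c|move=> _ [p /mem_set Ap <-]; exact: Fc].
by move=> [m mmax]; rewrite /maximum; have [] := xgetPex 0 (ex_intro _ m mmax).
Qed.

Lemma mnorm_sub_continuous (R : realType) (n : nat) (M : 'M[R]_n)
    (x0 : 'cV[R]_n) : spd M -> continuous (fun x : 'cV[R]_n => mnorm M (x - x0)).
Proof.
move=> Mspd; have [C _ HC] := mnorm_le_norm Mspd.
apply: (@lipschitz_continuous _ _ _ _ C) => x y.
apply: le_trans (mnorm_dist Mspd _ _) _.
by rewrite opprB subrKA; exact: HC.
Qed.

Lemma compact_mball (R : realType) (n : nat) (M : 'M[R]_n) (x0 : 'cV[R]_n)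
    (r : R) : spd M -> compact (mball M x0 r).
Proof.
move=> Mspd; have [rho Hrho] := mball_norm_le x0 r Mspd.
apply: subclosed_compact (@compact_norm_ball R n rho) Hrho.
rewrite (_ : mball M x0 r =
  (fun x => mnorm M (x - x0)) @^-1` [set z : R | z <= r])//.
apply: preimage_closed; last exact: closed_le.
by move=> x _; exact: mnorm_sub_continuous.
Qed.

(** Two solutions are bounded on the compact interval, hence lie in a common box on which [f] is
    Lipschitz in the state. *)
Lemma solution_unique (R : realType) (n : nat) (f : R * 'cV[R]_n -> 'cV[R]_n)
    (a b : R) (u v : R -> 'cV[R]_n) : smooth f -> a <= b -> u a = v a ->
  (forall s, a <= s <= b -> is_derive s (1 : R) u (f (s, u s))) ->
  (forall s, a <= s <= b -> is_derive s (1 : R) v (f (s, v s))) ->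
  u b = v b.
Proof.
move=> fsmooth ab uva Hu Hv.
have bounded (w : R -> 'cV[R]_n) :
    (forall s, a <= s <= b -> is_derive s (1 : R) w (f (s, w s))) ->
    exists C, forall s, a <= s <= b -> `|w s| <= C.
  move=> Hw; have cw : {within `[a, b], continuous (fun s => `|w s|)}.
    apply: continuous_in_subspaceT => s; rewrite inE/= in_itv/= => sab.
    apply: continuous_comp; last exact: norm_continuous.
    exact: is_derive_continuous (Hw _ sab).
  have [c _ Hc] := EVT_max ab cw.
  by exists `|w c| => s sab; apply: Hc; rewrite in_itv.
have [Cu HCu] := bounded u Hu; have [Cv HCv] := bounded v Hv.
pose r := Num.max (`|a| + `|b|) (Num.max Cu Cv).
have [L _ HL] := smooth_lipschitz_box r fsmooth.
apply: (@gronwall_unique _ _ u v _ _ a b L ab uva Hu Hv) => s sab.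
apply: HL; rewrite /r !le_max ?HCu ?HCv ?orbT//.
apply/orP; left; move/andP: sab.
have := ler_norm b; have := ler_norm (- a); rewrite normrN.
have := normr_ge0 a; have := normr_ge0 b.
by move=> ? ? ? ? []; rewrite ler_norml; lra.
Qed.

(** The set of values is the image of the compact product of the ball and [[0, h]] under a
    continuous function, so its maximum is attained. *)
Lemma scaled_field_le_maximum (R : realType) (n : nat)
    (f : R * 'cV[R]_n -> 'cV[R]_n) (M : 'M[R]_n) (x0 : 'cV[R]_n)
    (t0 h r : R) : smooth f -> spd M -> 0 <= r ->
  forall x s, mball M x0 r x -> 0 <= s <= h ->
  mnorm M (h *: f (t0 + s, x)) <=
  maximum [set mnorm M (h *: f (t0 + s, x)) | x in mball M x0 r & s in `[0, h]].
Proof.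
move=> fsmooth Mspd r0 x s xr s0h.
pose F (p : 'cV[R]_n * R) := mnorm M (h *: f (t0 + p.2, p.1)).
have -> : [set mnorm M (h *: f (t0 + s, x)) | x in mball M x0 r & s in `[0, h]] =
    F @` (mball M x0 r `*` `[0, h]).
  apply/seteqP; split => [_ [y yr [t t0h <-]]|_ [[y t] [/= yr t0h] <-]].
    by exists (y, t).
  by exists y => //; exists t.
have s0h' : `[0, h]%classic s by rewrite /= in_itv.
apply: (maximum_ubound (F := F)); last by exists (x, s).
- by apply: compact_setX; [exact: compact_mball|exact: segment_compact].
- by exists (x, s).
- move=> p; apply: continuous_comp; last exact: mnorm_continuous.
  apply: continuous_comp; last exact: scaler_continuous.
  apply: continuous_comp; last exact: (fsmooth 0%N).
  apply: (@continuous_pair _ _ _ (fun p : 'cV[R]_n * R => t0 + p.2)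
    (fun p : 'cV[R]_n * R => p.1)) => {}p; last exact: cvg_fst.
  by apply: continuousD; [exact: cst_continuous|exact: cvg_snd].
Qed.

Lemma solution_in_mball (R : realType) (n : nat)
    (f : R * 'cV[R]_n -> 'cV[R]_n) (M : 'M[R]_n) (x0 xbar : 'cV[R]_n)
    (t0 h delta m r : R) : smooth f -> spd M -> 0 < h -> 0 < r ->
  delta + m <= r ->
  (forall x s, mball M x0 r x -> 0 <= s <= h ->
    mnorm M (h *: f (t0 + s, x)) <= m) ->
  mball M x0 delta xbar ->
  exists2 v : R -> 'cV[R]_n, v t0 = xbar &
    forall s, t0 <= s <= t0 + h ->
      is_derive s (1 : R) v (f (s, v s)) /\ mball M x0 r (v s).
Proof.
move=> fsmooth Mspd h0 r0 dmr fm xbard.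
have t0h : t0 <= t0 + h by rewrite lerDl ltW.
have [v v0 Hv] := truncation_solution x0 fsmooth Mspd t0h r0 t0 xbar.
(* The speed bound holds at every argument, because the truncation evaluates [f] only where [fm]
   applies; confining [v] therefore needs no continuation argument. *)
have gm p : mnorm M (truncation f M t0 (t0 + h) x0 r p) <= m / h.
  rewrite ler_pdivlMr// mulrC -[h in h * _]gtr0_norm// -mnormZ//.
  have /andP[c1 c2] := clamp_in p.1 t0h.
  rewrite /truncation -(subrK t0 (clamp _ _ _)) [_ - t0 + _]addrC.
  by apply: fm; [exact: retract_in|lra].
have m0 : 0 <= m.
  by have := le_trans (mnorm_ge0 M _) (gm (0, 0)); rewrite pmulr_lge0 ?invr_gt0.
have vball s : t0 <= s <= t0 + h -> mball M x0 r (v s).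
  move=> /andP[t0s st0h]; rewrite /mball/=.
  (* The displacement from [xbar] is at most [m / h] times [s - t0], hence at most [m], and [xbar]
     is within [delta] of [x0]. *)
  have -> : v s - x0 = (v s - v t0) + (xbar - x0) by rewrite v0 subrKA.
  apply: le_trans (mnormD Mspd _ _) _; apply: le_trans dmr; rewrite addrC.
  apply: lerD => //.
  have := @mnorm_mean_value _ _ _ Mspd v _ _ _ _ t0s (fun r _ => Hv r)
    (fun r _ => gm _).
  move=> /le_trans; apply; rewrite mulrAC ler_pdivrMr//.
  by apply: ler_wpM2l => //; lra.
exists v => // s st; split; last exact: vball.
have := Hv s; rewrite /truncation/= clamp_id// retract_id//; exact: vball.
Qed.

Lemma flow_exists_in_mball (R : realType) (n : nat)
    (f : R * 'cV[R]_n -> 'cV[R]_n) (M : 'M[R]_n) (x0 : 'cV[R]_n)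
    (a b r : R) (v : R -> 'cV[R]_n) : smooth f -> spd M -> a <= b -> 0 < r ->
  (forall s, a <= s <= b ->
    is_derive s (1 : R) v (f (s, v s)) /\ mball M x0 r (v s)) ->
  flow_exists f a b (v a).
Proof.
move=> fsmooth Mspd ab r0 Hv.
have ab1 : a - 1 <= b + 1 by lra.
have r1 : 0 < r + 1 by lra.
have [u ua Hu] := truncation_solution x0 fsmooth Mspd ab1 r1 a (v a).
have [L _ HL] := truncation_lipschitz x0 fsmooth Mspd ab1 r1.
have vtrunc s : a <= s <= b ->
    f (s, v s) = truncation f M (a - 1) (b + 1) x0 (r + 1) (s, v s).
  move=> sab; have [_ vr] := Hv s sab; move/andP: sab => [as_ sb].
  rewrite /truncation/= clamp_id ?retract_id//; last by apply/andP; split; lra.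
  by move: vr; rewrite /mball/=; lra.
(* On [[a, b]] both curves solve the enlarged truncated equation, whose global Lipschitz constant
   feeds Gronwall. *)
have uv s : a <= s <= b -> u s = v s.
  move=> /andP[as_ sb]; apply: (gronwall_unique (L := L) as_ ua (fun r _ => Hu r)
    (dv := fun s => f (s, v s))) => q /andP[aq qs].
    by have [] := Hv q; first by rewrite aq (le_trans qs).
  by rewrite vtrunc ?HL// aq (le_trans qs).
have margin s : a <= s <= b ->
    \forall q \near s, mnorm M (u q - x0) < r + 1.
  move=> sab; have us : mnorm M (u s - x0) < r + 1.
    by rewrite uv//; have [_] := Hv s sab; rewrite /mball/=; lra.
  have cu : {for s, continuous (fun q => mnorm M (u q - x0))}.
    apply: (@continuous_comp _ _ _ u (fun x => mnorm M (x - x0))).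
      exact: is_derive_continuous (Hu s).
    exact: mnorm_sub_continuous.
  exact: (cvgr_lt _ cu _ us).
have /margin/nbhs_ballP[e1 /= e10 He1] : a <= a <= b by rewrite lexx.
have /margin/nbhs_ballP[e2 /= e20 He2] : a <= b <= b by rewrite lexx andbT.
(* The 1 keeps times in the clamping interval; [e1] and [e2] keep [u] in the enlarged ball just
   before [a] and just after [b]. *)
pose e := Num.min 1 (Num.min e1 e2).
have e0 : 0 < e by rewrite !lt_min ltr01 e10.
have [ee1 ee2] : e <= e1 /\ e <= e2 by rewrite /e !ge_min !lexx !orbT.
have e1' : e <= 1 by rewrite ge_min lexx.
exists (a - e), (b + e), u; split => //.
  by move=> s /=; rewrite !in_itv/= => /andP[? ?]; apply/andP; split; lra.
move=> s /=; rewrite in_itv/= => /andP[as_ sb].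
have := Hu s; rewrite /truncation/= clamp_id; last by apply/andP; split; lra.
rewrite retract_id// /mball/=; have [sa|sa] := ltP s a.
  apply/ltW/He1; rewrite -ball_normE/= ger0_norm; lra.
have [bs|bs] := ltP b s.
  apply/ltW/He2; rewrite -ball_normE/= ler0_norm; lra.
have sab : a <= s <= b by rewrite sa.
by rewrite uv//; have [_] := Hv s sab; rewrite /mball/=; lra.
Qed.

Unset Implicit Arguments.

Theorem theorem3 (R : realType) (n : nat) (f : R * 'cV[R]_n -> 'cV[R]_n)
    (fsmooth : smooth f)
    (x0 : 'cV[R]_n) (t0 h : R) (h_gt0 : 0 < h)
    (M0 : 'M[R]_n) (M0spd : spd M0)
    (delta0 Delta0 : R) (delta0_gt0 : 0 < delta0) (Delta0_gt0 : 0 < Delta0)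
    (bound : delta0 +
       maximum [set mnorm M0 (h *: f (t0 + s, x)) |
                 x in mball M0 x0 Delta0 & s in `[0, h]] <= Delta0) :
  forall xbar : 'cV[R]_n, mball M0 x0 delta0 xbar ->
    flow_exists f t0 (t0 + h) xbar /\
    flow_tube f t0 (t0 + h) xbar `<=` mball M0 x0 Delta0.
Proof.
move=> xbar xbar_in.
(* The hypothesis [bound] is used with [m] the maximum itself. *)
have [v v0 Hv] := solution_in_mball fsmooth M0spd h_gt0 Delta0_gt0 bound
  (scaled_field_le_maximum t0 fsmooth M0spd (ltW Delta0_gt0)) xbar_in.
have t0h : t0 <= t0 + h by rewrite lerDl ltW.
split; first by rewrite -v0; exact: flow_exists_in_mball Hv.
move=> y [t /=]; rewrite in_itv/= => /andP[t0t tt1].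
move=> [a [b [w [+ + Hw w0 <-]]]]; rewrite !in_itv/= => /andP[at0 _] /andP[_ tb].
(* The solution [w] behind a point of the tube lives on its own interval, which contains [[t0, t]];
   uniqueness identifies it with the confined [v]. *)
have -> : w t = v t.
  apply: (solution_unique fsmooth t0t); first by rewrite w0 v0.
    move=> s /andP[t0s st]; apply: Hw; rewrite /= in_itv/=.
    by rewrite (lt_le_trans at0)// (le_lt_trans st).
  by move=> s /andP[t0s st]; have [] := Hv s; first by rewrite t0s (le_trans st).
by have [] := Hv t; first by rewrite t0t.
Qed.
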